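(* Let $C$ be a non-empty finite subset of $\mathbb{Z}$ and let $X\subseteq\mathbb{N}\setminus\{0\}$ be a $C$-admissible set. Let $D$ be the set formed by all positive divisors of $\gcd(C\cup X)$. Then $${\rm I}(C,X)=\bigcup_{d\in D}\left\{dS : S\in{\rm NI}\left(\tfrac{C}{d},\tfrac{X}{d}\right)\right\}.$$
   Context: $\mathbb{N}$ denotes the set of non-negative integers. For $C\subseteq\mathbb{Z}$, a $C$-incentive is a submonoid $M$ of $(\mathbb{N},+)$ such that $s+t+c\in M$ for all $s,t\in M\setminus\{0\}$ and all $c\in C$; it is numerical if $\gcd(M)=1$. A set $X\subseteq\mathbb{N}$ is $C$-admissible if there exists at least one $C$-incentive containing it. ${\rm I}(C,X)$ (resp. ${\rm NI}(C,X)$) is the set of all $C$-incentives (resp. numerical $C$-incentives) containing $X$. For an integer $d\geq 1$ and a set $Y$ of integers all divisible by $d$, $\frac{Y}{d}=\{y/d : y\in Y\}$; and $dS=\{ds : s\in S\}$.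
   Formalization: X is additionally assumed non-empty: for X = ∅ the claim fails, since {0} is a C-incentive containing ∅ but is not dS for any numerical S, as gcd({0}) = 0. *)

(* Defs.v *)
From mathcomp Require Import all_boot all_order all_algebra.
From mathcomp Require Import all_classical.

Set Implicit Arguments.
Unset Strict Implicit.
Unset Printing Implicit Defensive.

Import Order.TTheory GRing.Theory Num.Theory.
Local Open Scope classical_set_scope.
Local Open Scope ring_scope.

(* Sets of naturals are kept as [set nat]; [intset M] is M viewed inside Z. *)
Definition intset (M : set nat) : set int := [set m%:Z | m in M].

(* The gcd of a possibly infinite set of integers: the natural number whose
   divisors are exactly the common divisors of A. It is 0 iff A is included
   in {0}. *)
Definition is_set_gcd (A : set int) (g : nat) : Prop :=
  forall d : nat, (d %| g)%N <-> (forall a : int, A a -> (d%:Z %| a)%Z).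

Definition set_gcd (A : set int) : nat := xget 0%N [set g | is_set_gcd A g].

Lemma is_set_gcd_uniq (A : set int) (g h : nat) :
  is_set_gcd A g -> is_set_gcd A h -> g = h.
Proof.
move=> Ag Ah; apply/eqP; rewrite eqn_dvd.
by apply/andP; split; [apply/Ah/Ag | apply/Ag/Ah].
Qed.

Lemma is_set_gcd_ex (A : set int) : exists g, is_set_gcd A g.
Proof.
have [A0|] := pselect (forall a, A a -> a = 0).
  by exists 0%N => d; split=> [_ a /A0 ->|_]; rewrite ?dvdz0 ?dvdn0.
move=> /existsNP[a0 /not_implyP[Aa0 /eqP a0N0]].
have Pex : exists n, `[< (0 < n)%N /\ forall d : nat,
    (forall a : int, A a -> (d%:Z %| a)%Z) -> (d %| n)%N >].
  exists `|a0|%N; apply/asboolP; split; first by rewrite absz_gt0.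
  by move=> d /(_ _ Aa0).
have [n /asboolP[n0 nP] nmin] := ex_minnP Pex.
exists n => d; split=> [dn a Aa|]; last exact: nP.
suff na : (n %| `|a|)%N by rewrite dvdzE (dvdn_trans dn).
suff /eqP <- : gcdn n `|a| == n by exact: dvdn_gcdr.
rewrite eqn_leq dvdn_leq ?dvdn_gcdl //=.
apply: nmin; apply/asboolP; split; first by rewrite gcdn_gt0 n0.
by move=> e eA; rewrite dvdn_gcd nP //=; exact: eA.
Qed.

Lemma set_gcdP (A : set int) : is_set_gcd A (set_gcd A).
Proof. by have [g Ag] := is_set_gcd_ex A; exact: (xgetPex 0%N (ex_intro _ g Ag)). Qed.

Definition submonoid (M : set nat) : Prop :=
  M 0%N /\ (forall s t : nat, M s -> M t -> M (s + t)%N).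

(* s + t + c is computed in Z, so membership in M also forces it to be
   non-negative. *)
Definition incentive (C : set int) (M : set nat) : Prop :=
  submonoid M /\
  (forall (s t : nat) (c : int), (M `\ 0%N) s -> (M `\ 0%N) t -> C c ->
     intset M (s%:Z + t%:Z + c)).

Definition numerical (M : set nat) : Prop := set_gcd (intset M) = 1%N.

Definition incentives (C : set int) (X : set nat) : set (set nat) :=
  [set M | incentive C M /\ X `<=` M].

Definition numerical_incentives (C : set int) (X : set nat) : set (set nat) :=
  [set M | [/\ incentive C M, numerical M & X `<=` M]].

Definition admissible (C : set int) (X : set nat) : Prop :=
  exists M : set nat, incentive C M /\ X `<=` M.

(* Euclidean quotients, meaningful as Y / d when d divides every element. *)
Definition quotz (C : set int) (d : nat) : set int :=
  [set (c %/ d%:Z)%Z | c in C].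
Definition quotn (X : set nat) (d : nat) : set nat :=
  [set (x %/ d)%N | x in X].

Definition dilate (d : nat) (S : set nat) : set nat :=
  [set (d * s)%N | s in S].

Definition positive_divisors (g : nat) : set nat :=
  [set d | (0 < d)%N /\ (d %| g)%N].

(* Main.v *)
(** Dilation by d > 0 identifies the (C/d)-incentives with the C-incentives all
    of whose elements are multiples of d, as soon as d divides C.  A C-incentive
    M containing X is thus recovered from d = gcd M: this d divides X, and for
    x in X it divides c = (x + x + c) - 2x for every c in C. *)
Require Import Defs.
From mathcomp Require Import all_boot all_order all_algebra.
From mathcomp Require Import all_classical.
From mathcomp Require Import ring.

Import GRing.Theory.
Local Open Scope classical_set_scope.
Local Open Scope ring_scope.

Lemma set_gcd_dvd (A : set int) (a : int) : A a -> ((set_gcd A)%:Z %| a)%Z.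
Proof. by move=> Aa; apply: (set_gcdP A _).1 Aa. Qed.

Lemma set_gcd_intset_dvd (M : set nat) (m : nat) :
  M m -> (set_gcd (intset M) %| m)%N.
Proof.
by move=> Mm; have := @set_gcd_dvd (intset M) m%:Z; apply; exists m.
Qed.

(** The preimage of M under multiplication by [d] encodes M / d without any division. If [e] is its
    gcd, then [d * e] divides every element of M, hence divides [d]; cancelling the positive [d]
    leaves [e] dividing 1. *)
Lemma numerical_set_gcd_preimage (M : set nat) :
  let d := set_gcd (intset M) in
  (0 < d)%N -> numerical [set s | M (d * s)%N].
Proof.
move=> d d_gt0; set S := [set s | _]; apply/eqP; rewrite -dvdn1.
set e := set_gcd _; rewrite -(dvdn_pmul2l d_gt0) muln1.
apply/(set_gcdP (intset M) _) => _ [m Mm <-].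
have /dvdnP[k mE] : (d %| m)%N by exact: set_gcd_intset_dvd.
rewrite dvdzE /= mE mulnC dvdn_pmul2r //.
by apply: set_gcd_intset_dvd; rewrite /S /= mulnC -mE.
Qed.

Lemma dilate_preimage (d : nat) (M : set nat) :
  (forall m, M m -> (d %| m)%N) -> dilate d [set s | M (d * s)%N] = M.
Proof.
move=> dM; apply/seteqP; split=> [_ [s Ms <-] //|m Mm].
have /dvdnP[k mE] := dM _ Mm.
by exists k; rewrite /= mulnC -mE.
Qed.

Section Dilation.

Variables (C : set int) (d : nat).
Hypotheses (d_gt0 : (0 < d)%N) (dC : forall c, C c -> (d%:Z %| c)%Z).

Let dZ_neq0 : d%:Z != 0.
Proof. by rewrite -lt0n. Qed.

(** Division of [c] by [d] is exact, so [d] factors out of the incentive sum. Both transfers below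
    rest on this. *)
Let dilate_sumE (s t : nat) (c : int) : C c ->
  (d * s)%N%:Z + (d * t)%N%:Z + c = d%:Z * (s%:Z + t%:Z + (c %/ d)%Z).
Proof. by move=> /dC/divzK cE; rewrite -[in LHS]cE !PoszM; ring. Qed.

Lemma incentive_preimage (M : set nat) :
    (forall m, M m -> (d %| m)%N) ->
  incentive C M -> incentive (quotz C d) [set s | M (d * s)%N].
Proof.
move=> dM [[M0 MD] MC]; split; first split=> [|s t Ms Mt] /=.
- by rewrite muln0.
- by rewrite mulnDr; exact: MD.
- move=> s t _ [Ms /eqP s0] [Mt /eqP t0] [c Cc <-].
  have [||m Mm mE] := MC (d * s)%N (d * t)%N c _ _ Cc.
  + by split=> //; apply/eqP; rewrite muln_eq0 negb_or -lt0n d_gt0.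
  + by split=> //; apply/eqP; rewrite muln_eq0 negb_or -lt0n d_gt0.
  (* As an element of M the sum is a natural multiple [d * k]; cancelling [d] in Z identifies the
     sum for M / d with [k], which is thereby non-negative. *)
  have /dvdnP[k mk] := dM _ Mm.
  exists k; first by rewrite /= mulnC -mk.
  by apply: (mulfI dZ_neq0); rewrite -dilate_sumE // -mE mk PoszM mulrC.
Qed.

Lemma incentive_dilate (S : set nat) :
  incentive (quotz C d) S -> incentive C (dilate d S).
Proof.
move=> [[S0 SD] SC]; split; first split.
- by exists 0%N; rewrite ?muln0.
- move=> _ _ [s Ss <-] [t St <-].
  by exists (s + t)%N; [exact: SD|rewrite mulnDr].
- move=> _ _ c [[s Ss <-] s0] [[t St <-] t0] Cc.
  have [|||m Sm mE] := SC s t (c %/ d)%Z.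
  + by split=> // s0E; apply: s0; rewrite s0E /= muln0.
  + by split=> // t0E; apply: t0; rewrite t0E /= muln0.
  + by exists c.
  exists (d * m)%N; first by exists m.
  by rewrite dilate_sumE // -mE PoszM.
Qed.

End Dilation.

Lemma incentive_gcd_dvd (C : set int) (M : set nat) (x : nat) (c : int) :
  incentive C M -> M x -> x != 0%N -> C c -> ((set_gcd (intset M))%:Z %| c)%Z.
Proof.
move=> [_ MC] Mx /eqP x0 Cc.
have dx : ((set_gcd (intset M))%:Z %| x%:Z)%Z by apply: set_gcd_dvd; exists x.
have : ((set_gcd (intset M))%:Z %| x%:Z + x%:Z + c)%Z.
  by apply/set_gcd_dvd/MC.
by rewrite rpredDl ?rpredD.
Qed.

Theorem theorem7p4 (C : set int) (X : set nat)
    (C_nonempty : C !=set0) (C_finite : finite_set C)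
    (X_nonempty : X !=set0) (X_pos : X `<=` [set~ 0%N])
    (X_admissible : admissible C X) :
  let D := positive_divisors (set_gcd (C `|` intset X)) in
  incentives C X =
    \bigcup_(d in D)
      [set dilate d S | S in numerical_incentives (quotz C d) (quotn X d)].
Proof.
move=> D; apply/seteqP; split=> [M [CM XM]|_ [d [d_gt0 dg] [S [CS _ XS] <-]]].
- set d := set_gcd (intset M).
  have dM m : M m -> (d %| m)%N by exact: set_gcd_intset_dvd.
  have [x Xx] := X_nonempty.
  have x0 : x != 0%N by apply/eqP/X_pos.
  have dC c : C c -> (d%:Z %| c)%Z by apply: incentive_gcd_dvd CM (XM _ Xx) x0.
  (* A zero gcd could not divide the nonzero [x]. *)
  have d_gt0 : (0 < d)%N by apply: dvdn_gt0 (dM _ (XM _ Xx)); rewrite lt0n.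
  exists d; first split=> //.
    by apply/set_gcdP => a [/dC //|[y /XM/dM dy <-]]; rewrite dvdzE.
  exists [set s | M (d * s)%N]; last exact: dilate_preimage.
  split; [exact: incentive_preimage|exact: numerical_set_gcd_preimage|].
  (* Since [y] lies in M, [d] divides it, and [d * (y %/ d)] is [y] itself. *)
  by move=> _ [y /XM My <-]; rewrite /= mulnC divnK ?dM.
(* Conversely, [d] divides every element of C, so dilation by [d] yields a C-incentive; it also
   divides every [x] in X, so [x] is the dilate of [x %/ d]. *)
- have /set_gcdP dCX := dg.
  split; first by apply: incentive_dilate CS => // c Cc; apply: dCX; left.
  move=> x Xx; exists (x %/ d)%N; first by apply: XS; exists x.
  have := dCX x%:Z; rewrite dvdzE mulnC => dx; apply: divnK.
  by apply: dx; right; exists x.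
Qed.
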